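(* Let $A=(a_1,\dots,a_n)$ be positive integers with $a_1\le\dots\le a_n=k+1$, $k\ge1$, and let $A_1=(a_1,\dots,a_n,a_n,a_n)\in\mathbb N^{n+2}$. Then, in $F^{\otimes k}$, $$w_A\in U(\mathfrak{sl}_2\otimes\mathbb C[z^{-1}])\,w_{A_1}.$$
   Context: $\widehat{\mathfrak{sl}}_2=\mathfrak{sl}_2\otimes\mathbb C[z,z^{-1}]\oplus\mathbb Cc$, $x_i=x\otimes z^i$, $c$ central, $[x_i,y_j]=[x,y]_{i+j}-i\delta_{i+j,0}(x,y)c$, $(x,y)=\mathrm{tr}(xy)$; $e,f,h$ is the standard basis of $\mathfrak{sl}_2$, and $\mathfrak{sl}_2\otimes\mathbb C[z^{-1}]$ is spanned by the $x_i$ with $i\le0$. The fermionic space $F$: let $\psi(i),\phi(i)$, $i\in\mathbb Z$, be mutually anticommuting variables with zero squares. $F$ has basis the semi-infinite monomials $\dots\psi(N-1)\phi(N-1)\psi(N)\phi(N)\,\psi(i_1)\cdots\psi(i_s)\,\phi(j_1)\cdots\phi(j_t)$, $N<i_1<\dots<i_s$, $N<j_1<\dots<j_t$. $\psi(i),\phi(i)$ act by right multiplication, $\psi^*(i),\phi^*(i)$ by (right) differentiation with respect to $\psi(-i),\phi(-i)$, so $[\psi^*(i),\psi(j)]_+=[\phi^*(i),\phi(j)]_+=\delta_{i+j,0}$ and all other anticommutators vanish. $\widehat{\mathfrak{sl}}_2$ acts on $F$ with $c=1$ by $e(z)=\sum_ie_iz^i=\psi(z)\phi(z)$, $f(z)=\sum_if_iz^i=\phi^*(z)\psi^*(z)$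 (where $a(z)=\sum_ia(i)z^i$), with $h_i$ determined by the commutation relations. $F^{\otimes k}$ is then a level $k$ module. Vectors: $v(2N)=\dots\psi(N-1)\phi(N-1)\psi(N)$, $v(2N+1)=\dots\psi(N-1)\phi(N-1)\psi(N)\phi(N)$. For a tuple $A$ of positive integers of length $n$ with maximum $k+1$ and $d_j=\#\{i:a_i=j\}$, $$w_A=v(d_1-n)\otimes v(d_1+d_2-n)\otimes\cdots\otimes v(d_1+\cdots+d_k-n)\in F^{\otimes k},$$ i.e. the $i$-th factor is $v(-(d_{i+1}+\cdots+d_{k+1}))$. *)

(* Defs.v *)
From HB Require Import structures.
From mathcomp Require Import all_boot all_order all_algebra.
From mathcomp Require Import finmap zify.
From mathcomp Require Import boolp classical_sets cardinality fsbigop reals complex freeg.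

Set Implicit Arguments.
Unset Strict Implicit.
Unset Printing Implicit Defensive.

Import Order.TTheory GRing.Theory Num.Theory.

Local Open Scope fset_scope.
Local Open Scope ring_scope.

(* The fermions are numbered by int, in the order
     ... psi(N-1) phi(N-1) psi(N) phi(N) psi(N+1) phi(N+1) ...,
   psi(N) having position 2N and phi(N) position 2N+1.  Up to sign a
   semi-infinite monomial is determined by the set S of positions of its
   factors, which contains every q << 0 and no q >> 0; the basis vector chosen
   for S is the product of its factors in increasing order of position.
   S is encoded by the finite set D = S (+) {q | q <= 0} (symmetric
   difference), so that every finite set encodes exactly one monomial. *)
Definition maya : Type := {fset int}.
HB.instance Definition _ := Choice.on maya.

Definition occ (D : maya) (q : int) : bool := (q <= 0) (+) (q \in D).

Definition toggle (p : int) (D : maya) : maya :=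
  if p \in D then D `\ p else p |` D.

(* The monomial with factors at all positions q <= m; since psi(N), phi(N) have
   positions 2N, 2N+1, these are v(2N) = ... psi(N-1) phi(N-1) psi(N) and
   v(2N+1) = ... psi(N-1) phi(N-1) psi(N) phi(N). *)
Definition vmaya (m : int) : maya :=
  match m with
  | Posz n => [fset Posz j.+1 | j in iota 0 n]
  | Negz n => [fset - Posz j | j in iota 0 n.+1]
  end.

Definition above (D : maya) (p : int) : {fset int} :=
  [fset q in vmaya p `|` D | (p < q) && occ D q].

Lemma occ_toggle p D q : occ (toggle p D) q = occ D q (+) (q == p).
Proof.
rewrite /occ /toggle; case: ifP => pD; rewrite !inE;
  case: eqVneq => [->|_] //=; rewrite ?pD ?addbF ?addbT //=;
  by case: (p <= 0).
Qed.

Lemma occ_inj D D' : occ D =1 occ D' -> D = D'.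
Proof.
by move=> eqDD'; apply/fsetP => q; have /addbI := eqDD' q.
Qed.

Lemma occ_vmaya m q : occ (vmaya m) q = (q <= m).
Proof.
rewrite /occ; case: m => n /=.
- have -> : (q \in [fset Posz j.+1 | j in iota 0 n]) = (0 < q <= Posz n).
    apply/imfsetP/andP => [[j /=]|[]].
      by rewrite mem_iota add0n => jn ->.
    case: q => [[|j]|j] //= _ jn; exists j => //=.
    by rewrite -[in_mem _ _]/(j \in iota 0 n) mem_iota add0n.
  by case: q => [[|j]|j].
- have -> : (q \in [fset - Posz j | j in iota 0 n.+1]) = (Negz n < q <= 0).
    apply/imfsetP/andP => [[j /=]|[]].
      by rewrite -[0%N :: _]/(iota 0 n.+1) mem_iota add0n => jn ->; case: j jn.
    case: q => [[|j]|j] //= nj _.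
      by exists 0%N.
    exists j.+1 => //=.
    by rewrite -[in_mem _ _]/(j.+1 \in iota 0 n.+1) mem_iota add0n ltnS.
  by case: q => [[|j]|j] //=; rewrite ltNge; case: (_ <= _).
Qed.

Lemma in_above D p q : (q \in above D p) = (p < q) && occ D q.
Proof.
rewrite !inE /=; case: (boolP (p < q)) => pq; rewrite ?andbF //= andbC.
have := occ_vmaya p q; rewrite /occ [q <= p]leNgt pq /=.
by case: (q <= 0); case: (q \in vmaya p); case: (q \in D).
Qed.

Lemma toggleC p q D : toggle p (toggle q D) = toggle q (toggle p D).
Proof. by apply: occ_inj => r; rewrite !occ_toggle addbAC. Qed.

Lemma toggleK p : involutive (toggle p).
Proof. by move=> D; apply: occ_inj => r; rewrite !occ_toggle addbK. Qed.

Lemma occ_bound (D : maya) :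
  exists B : nat, forall q, (q < - B%:Z -> occ D q) /\ (B%:Z < q -> ~~ occ D q).
Proof.
exists (\sum_(q <- D) `|q|)%N => q.
have qB : q \in D -> (`|q| <= \sum_(q <- D) `|q|)%N.
  by move=> qD; rewrite (big_rem q) //= leq_addr.
by rewrite /occ; case: (q \in D) qB => [/(_ isT)|_] /=;
  rewrite ?addbT ?addbF; lia.
Qed.

Section Fermions.
Variable K : fieldType.

Definition fock : Type := {freeg maya / K}.
HB.instance Definition _ := GRing.Lmodule.on fock.

Definition mono_sign (D : maya) (p : int) : K := (-1) ^+ #|` above D p|.

(* Right multiplication by the fermion at position p, and right differentiation
   with respect to it: the sign comes from moving the fermion across the
   factors at positions > p. *)
Definition mul_fermion (p : int) : fock -> fock :=
  fglift (fun D : maya =>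
    if occ D p then 0 : fock else mono_sign D p *: << toggle p D >>).

Definition diff_fermion (p : int) : fock -> fock :=
  fglift (fun D : maya =>
    if occ D p then mono_sign D p *: << toggle p D >> else 0 : fock).

Lemma freegUZ (B : choiceType) (c a : K) (b : B) :
  c *: (<< a *g b >> : {freeg B / K}) = << (c * a) *g b >>.
Proof. by apply/eqP/freeg_eqP => b'; rewrite coeffZ !coeffU mulrA. Qed.

Lemma fglift_is_linear (B : choiceType) (V : lmodType K) (g : B -> V) :
  linear (fglift g : {freeg B / K} -> V).
Proof.
have gB : {morph (fglift g : {freeg B / K} -> V) : x y / x - y}.
  exact: lift_is_additive.
have g0 : fglift g (0 : {freeg B / K}) = 0 by rewrite -(subrr 0) gB subrr.
have gD : {morph (fglift g : {freeg B / K} -> V) : x y / x + y}.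
  by move=> x y; rewrite -[y in LHS]opprK gB -[- y]sub0r gB g0 sub0r opprK.
move=> c x y; rewrite gD; congr (_ + _).
rewrite -(freeg_sumE x) scaler_sumr !(big_morph _ gD g0) scaler_sumr.
apply: eq_bigr => b _; by rewrite liftU scalerA freegUZ liftU.
Qed.

HB.instance Definition _ p :=
  GRing.isLinear.Build K fock fock _ (mul_fermion p) (fglift_is_linear _).
HB.instance Definition _ p :=
  GRing.isLinear.Build K fock fock _ (diff_fermion p) (fglift_is_linear _).

Lemma mul_fermionU p D : mul_fermion p << D >> =
  if occ D p then 0 : fock else mono_sign D p *: << toggle p D >>.
Proof. by rewrite /mul_fermion liftU scale1r. Qed.

Lemma diff_fermionU p D : diff_fermion p << D >> =
  if occ D p then mono_sign D p *: << toggle p D >> else 0 : fock.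
Proof. by rewrite /diff_fermion liftU scale1r. Qed.

Lemma fockE (x : fock) : x = \sum_(D <- dom x) coeff D x *: (<< D >> : fock).
Proof.
rewrite -{1}(freeg_sumE x); apply: eq_bigr => D _.
by apply/eqP/freeg_eqP => D'; rewrite coeffZ !coeffU mul1r.
Qed.

Lemma fock_ext (u u' : {linear fock -> fock}) :
  (forall D : maya, u << D >> = u' << D >>) -> u =1 u'.
Proof.
move=> eq_uu' x; rewrite (fockE x) !linear_sum.
by apply: eq_bigr => D _; rewrite !linearZ eq_uu'.
Qed.

Lemma mono_sign_toggle p q D :
  mono_sign (toggle p D) q = (-1) ^+ (q < p)%R * mono_sign D q.
Proof.
rewrite /mono_sign; case: (boolP (q < p)) => qp; last first.
  rewrite mul1r; congr (_ ^+ #|` _|); apply/fsetP => r.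
  rewrite !in_above occ_toggle; case: eqVneq => [->|_]; rewrite ?addbF //.
  by rewrite (negbTE qp).
have aE E : occ E p -> above E q = p |` above (toggle p E) q.
  move=> Ep; apply/fsetP => r; rewrite in_fset1U !in_above occ_toggle.
  by case: eqVneq => [->|_]; rewrite ?addbF //= qp Ep.
have notin E : occ E p -> p \notin above (toggle p E) q.
  by move=> Ep; rewrite in_above occ_toggle Ep eqxx andbF.
case: (boolP (occ D p)) => Dp.
  by rewrite (aE _ Dp) cardfsU1 (notin _ Dp) exprD !expr1 mulrA mulrNN !mul1r.
have Dp' : occ (toggle p D) p by rewrite occ_toggle eqxx (negbTE Dp).
have := notin _ Dp'; rewrite (aE _ Dp') toggleK cardfsU1 => ->.
by rewrite exprD.
Qed.

Lemma mono_signK D p : mono_sign D p * mono_sign D p = 1.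
Proof. by rewrite -expr2 sqrr_sign. Qed.

Lemma fermion_sign (p q : int) D : p != q ->
  mono_sign D q * mono_sign (toggle q D) p
  + mono_sign D p * mono_sign (toggle p D) q = 0.
Proof.
move=> neq_pq; rewrite !mono_sign_toggle.
case: ltgtP neq_pq => //= _ _; rewrite !(expr0, expr1, mul1r, mulN1r) mulrN;
  by rewrite mulrC ?subrr ?addNr.
Qed.

Lemma mul_fermionZ p c (x : fock) :
  mul_fermion p (c *: x) = c *: mul_fermion p x.
Proof. exact: linearZ. Qed.

Lemma diff_fermionZ p c (x : fock) :
  diff_fermion p (c *: x) = c *: diff_fermion p x.
Proof. exact: linearZ. Qed.

Lemma mul_fermion0 p : mul_fermion p 0 = 0. Proof. exact: linear0. Qed.

Lemma diff_fermion0 p : diff_fermion p 0 = 0. Proof. exact: linear0. Qed.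

Definition fermionE :=
  (mul_fermionZ, diff_fermionZ, mul_fermion0, diff_fermion0,
   mul_fermionU, diff_fermionU, occ_toggle).

Lemma mul_mul_fermion p q (x : fock) :
  mul_fermion p (mul_fermion q x) + mul_fermion q (mul_fermion p x) = 0.
Proof.
pose u : {linear fock -> fock} :=
  (mul_fermion p \o mul_fermion q) \+ (mul_fermion q \o mul_fermion p).
pose u' : {linear fock -> fock} := \0.
suff uu' : u =1 u' by exact: uu' x.
apply: fock_ext => D; rewrite /u /u' /=.
rewrite !mul_fermionU; case Dq: (occ D q); case Dp: (occ D p);
  rewrite !fermionE ?Dp ?Dq ?(eq_sym q p) ?scaler0 ?addr0 //;
  case: eqVneq => [eq_pq|neq_pq] /=; rewrite ?scaler0 ?addr0 //;
  try by move: Dp; rewrite eq_pq Dq.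
by rewrite toggleC !scalerA -scalerDl fermion_sign // scale0r.
Qed.

Lemma diff_diff_fermion p q (x : fock) :
  diff_fermion p (diff_fermion q x) + diff_fermion q (diff_fermion p x) = 0.
Proof.
pose u : {linear fock -> fock} :=
  (diff_fermion p \o diff_fermion q) \+ (diff_fermion q \o diff_fermion p).
pose u' : {linear fock -> fock} := \0.
suff uu' : u =1 u' by exact: uu' x.
apply: fock_ext => D; rewrite /u /u' /=.
rewrite !diff_fermionU; case Dq: (occ D q); case Dp: (occ D p);
  rewrite !fermionE ?Dp ?Dq ?(eq_sym q p) ?scaler0 ?addr0 //;
  case: eqVneq => [eq_pq|neq_pq] /=; rewrite ?scaler0 ?addr0 //;
  try by move: Dp; rewrite eq_pq Dq.
by rewrite toggleC !scalerA -scalerDl fermion_sign // scale0r.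
Qed.

Lemma diff_mul_fermion p q (x : fock) :
  diff_fermion p (mul_fermion q x) + mul_fermion q (diff_fermion p x) =
  (p == q)%:R *: x.
Proof.
pose u : {linear fock -> fock} :=
  (diff_fermion p \o mul_fermion q) \+ (mul_fermion q \o diff_fermion p).
pose u' : {linear fock -> fock} := (p == q)%:R \*: idfun.
suff uu' : u =1 u' by exact: uu' x.
apply: fock_ext => D; rewrite /u /u' /=.
rewrite mul_fermionU diff_fermionU; case: (eqVneq p q) => [->|neq_pq].
  case Dq: (occ D q); rewrite !fermionE Dq eqxx /= scale1r scalerA toggleK;
  by rewrite mono_sign_toggle ltxx mul1r mono_signK scale1r ?add0r ?addr0.
rewrite scale0r; case Dq: (occ D q); case Dp: (occ D p);
  rewrite !fermionE ?Dp ?Dq ?(eq_sym q p) ?(negbTE neq_pq) /=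
          ?scaler0 ?addr0 //.
by rewrite toggleC !scalerA -scalerDl fermion_sign // scale0r.
Qed.

Definition psi (i : int) : fock -> fock := mul_fermion (2 * i).
Definition phi (i : int) : fock -> fock := mul_fermion (2 * i + 1).
Definition psis (i : int) : fock -> fock := diff_fermion (2 * - i).
Definition phis (i : int) : fock -> fock := diff_fermion (2 * - i + 1).

Lemma locally_finite (T : int -> fock -> fock) :
    (forall a c x y, T a (c *: x + y) = c *: T a x + T a y) ->
    (forall D : maya, exists B : nat,
       forall a, (B < `|a|)%N -> T a << D >> = 0) ->
  forall x, finite_set [set a | T a x != 0]%classic.
Proof.
move=> Tlin TD x.
have T0 a : T a 0 = 0.
  by have := Tlin a (-1) 0 0; rewrite !scaleN1r !addNr.
have TZ a c y : T a (c *: y) = c *: T a y by rewrite -[_ *: y]addr0 Tlin T0 addr0.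
have [B xB] : exists B : nat, forall a, (B < `|a|)%N -> T a x = 0.
  rewrite (fockE x).
  elim/big_ind: _ => [|y z [B yB] [B' zB']|D _].
  - by exists 0%N.
  - exists (maxn B B') => a; rewrite gtn_max => /andP[/yB ya /zB' za].
    by rewrite -[y]scale1r Tlin ya za scaler0 addr0.
  - by have [B DB] := TD D; exists B => a /DB Da; rewrite TZ Da scaler0.
apply: (@sub_finite_set _ _
  [set` [fset Posz j - Posz B | j in iota 0 (B + B).+1]]%classic) => /=.
  move=> a /= Ta; apply/imfsetP; exists (absz (a + B%:Z)).
    rewrite -[in_mem _ _]/(_ \in iota 0 (B + B).+1) mem_iota.
    by case: (ltnP B `|a|) Ta => [/xB ->|]; [rewrite eqxx|lia].
  by case: (ltnP B `|a|) Ta => [/xB ->|]; [rewrite eqxx|lia].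
exact: finite_fset.
Qed.

Lemma fock_e_finite i (x : fock) :
  finite_set [set a | psi a (phi (i - a) x) != 0]%classic.
Proof.
apply: (locally_finite (T := fun a y => psi a (phi (i - a) y))) => [a c y z|D].
  by rewrite /psi /phi !linearP.
have [B DB] := occ_bound D; exists (B + `|i| + 1)%N => a aB.
rewrite /psi /phi; case: (lerP 0 a) => a0.
  rewrite (mul_fermionU _ D).
  have -> : occ D (2 * (i - a) + 1) by apply: (DB _).1; lia.
  exact: linear0.
have /eqP := mul_mul_fermion (2 * a) (2 * (i - a) + 1) << D >>.
rewrite addr_eq0 => /eqP ->; rewrite (mul_fermionU _ D).
have -> : occ D (2 * a) by apply: (DB _).1; lia.
by rewrite mul_fermion0 oppr0.
Qed.

Lemma fock_f_finite i (x : fock) :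
  finite_set [set a | phis a (psis (i - a) x) != 0]%classic.
Proof.
apply: (locally_finite (T := fun a y => phis a (psis (i - a) y))) => [a c y z|D].
  by rewrite /psis /phis !linearP.
have [B DB] := occ_bound D; exists (B + `|i| + 1)%N => a aB.
rewrite /psis /phis; case: (lerP 0 a) => a0.
  rewrite (diff_fermionU _ D).
  have /negbTE -> : ~~ occ D (2 * - (i - a)) by apply: (DB _).2; lia.
  exact: linear0.
have /eqP := diff_diff_fermion (2 * - a + 1) (2 * - (i - a)) << D >>.
rewrite addr_eq0 => /eqP ->; rewrite (diff_fermionU _ D).
have /negbTE -> : ~~ occ D (2 * - a + 1) by apply: (DB _).2; lia.
by rewrite diff_fermion0 oppr0.
Qed.

(* Products of the fermionic operators are compositions of endomorphisms: the
   coefficient of z^i in psi(z) phi(z) is the sum of the psi(a) o phi(i - a). *)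
Definition fock_e (i : int) (x : fock) : fock :=
  \sum_(a \in [set: int]%classic) psi a (phi (i - a) x).

Definition fock_f (i : int) (x : fock) : fock :=
  \sum_(a \in [set: int]%classic) phis a (psis (i - a) x).

(* [e_i, f_0] = h_i - i delta_{i,0} c = h_i *)
Definition fock_h (i : int) (x : fock) : fock :=
  fock_e i (fock_f 0 x) - fock_f 0 (fock_e i x).

Inductive sl2_basis := sl2_e | sl2_f | sl2_h.

Definition fock_act (g : sl2_basis) : int -> fock -> fock :=
  match g with sl2_e => fock_e | sl2_f => fock_f | sl2_h => fock_h end.

(* The k-th tensor power of the space with basis maya: its basis consists of
   the pure tensors of basis vectors, i.e. of the k-tuples of elements of
   maya. *)
Definition fock_tensor (k : nat) : Type := {freeg {ffun 'I_k -> maya} / K}.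
HB.instance Definition _ k := GRing.Lmodule.on (fock_tensor k).

(* t_0 (x) ... (x) x (x) ... (x) t_(k-1), with x in position j *)
Definition put (k : nat) (t : {ffun 'I_k -> maya}) (j : 'I_k) :
    fock -> fock_tensor k :=
  fglift (fun D : maya =>
    << [ffun l => if l == j then D else t l] >> : fock_tensor k).

(* x_i acting on the tensor power through the iterated coproduct *)
Definition tensor_act (k : nat) (g : sl2_basis) (i : int) :
    fock_tensor k -> fock_tensor k :=
  fglift (fun t : {ffun 'I_k -> maya} =>
    \sum_(j < k) put t j (fock_act g i << t j >>)).

(* The image of U(sl_2 (x) C[z^-1]) in the endomorphisms of the tensor power:
   the subalgebra generated by the operators x_i, i <= 0. *)
Inductive env_neg (k : nat) : (fock_tensor k -> fock_tensor k) -> Prop :=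
  | env_one : env_neg id
  | env_gen (g : sl2_basis) (i : int) : i <= 0 -> env_neg (tensor_act g i)
  | env_add u u' : env_neg u -> env_neg u' -> env_neg (fun x => u x + u' x)
  | env_scale (c : K) u : env_neg u -> env_neg (fun x => c *: u x)
  | env_mul u u' : env_neg u -> env_neg u' -> env_neg (u \o u').

Definition env_neg_span (k : nat) (w : fock_tensor k) (x : fock_tensor k) :
    Prop :=
  exists2 u, env_neg u & x = u w.

(* 'I_k is 0-based: the factor with index i is v(d_1 + ... + d_(i+1) - n). *)
Definition wvec (k : nat) (A : seq nat) : fock_tensor k :=
  << [ffun i : 'I_k =>
       vmaya ((\sum_(1 <= j < i.+2) count_mem j A)%N%:Z - (size A)%:Z)] >>.

End Fermions.

(* Main.v *)
From HB Require Import structures.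
Require Import Defs.
From mathcomp Require Import all_boot all_order all_algebra.
From mathcomp Require Import zify.
From mathcomp Require Import boolp classical_sets functions fsbigop.
From mathcomp Require Import reals complex freeg.

(** Write the modes of e as a series in z. On one fermionic factor
    e(z) = psi(z) phi(z) squares to zero, and on v(m) its lowest nonzero mode
    is e_(m+1), which sends v(m) to +-v(m+2), the two sites just above m
    getting filled. Passing from A_1 to A raises every factor of the vector by
    one such step, say from v(m_j) to v(m_j + 2).

    If all the modes of e were available, the coefficient of e(z)^k at
    z^(sum_j (m_j + 1)) would do: the square of e(z) vanishes on every factor,
    so e(z)^k acts as k! times the product of the k single-factor currents,
    and its lowest coefficient on the tensor product of the v(m_j) is, up to
    sign, k! times the tensor product of the v(m_j + 2). Only modes i <= 0 are
    allowed, and the point is that the truncation e_-(z), the sum of the e_i z^i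
    with i <= 0, has the same coefficient. After the shift a = i + 2B, which
    makes all relevant modes natural numbers, put X = e(z), G = e_-(z) and
    H = X - G, and let M = 2B, so that H has order at least M + 1. Each factor
    has its lowest mode b_j at most M, because m_j < 0. A product of p
    single-factor currents has order sum_j b_j minus the b_j of the k - p
    missing factors, hence at least sum_j b_j - (k - p) M. In the expansion of
    G^k = (X - H)^k, a term with k - p factors H therefore has order at least
    sum_j b_j + (k - p), and only X^k reaches the coefficient at sum_j b_j. This
    is [total_trunc_leading], an abstract statement on commuting families of
    operators.

    Its hypotheses are checked in the fermionic space. There psi(a) and phi(a)
    kill any given vector for a << 0, so each e_i is a finite sum on it;
    this gives the commutation of the e_i ([fock_eC]), the relation
    e(z)^2 = 0 ([fock_e_square]) and the lowest mode on v(m)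
    ([fock_e_vmaya]). *)

Set Implicit Arguments.
Unset Strict Implicit.
Unset Printing Implicit Defensive.

Import Order.TTheory GRing.Theory Num.Theory.

Local Open Scope ring_scope.

(** * Formal series of vectors *)

Section Series.
Variable V : zmodType.
Implicit Types (T S : nat -> V -> V) (g : nat -> V).

Lemma seqD g g' c : (g + g') c = g c + g' c. Proof. by []. Qed.

Lemma seqB g g' c : (g - g') c = g c - g' c. Proof. by []. Qed.

Lemma seqMn g n c : (g *+ n) c = g c *+ n.
Proof. by elim: n => // n IH; rewrite !mulrS seqD IH. Qed.

(** A family [T] of operators is read as the operator-valued series
    [T(z) = \sum_a T a z^a], and a sequence of vectors as the series with these
    coefficients. *)
Definition conv T g : nat -> V :=
  fun c => \sum_(a < c.+1) T a (g (c - a)%N).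

Definition const_series (u : V) : nat -> V := fun c => if c is 0 then u else 0.

Definition addfam T := forall a, {morph T a : u v / u + v}.

Lemma addfam0 T : addfam T -> forall a, T a 0 = 0.
Proof.
by move=> Tadd a; apply: (@addrI _ (T a 0)); rewrite -Tadd !addr0.
Qed.

Lemma convD T : addfam T -> {morph conv T : g g' / g + g'}.
Proof.
move=> Tadd g g'; apply/funext => c; rewrite seqD /conv -big_split.
by apply: eq_bigr => a _; rewrite seqD Tadd.
Qed.

Lemma conv0 T : addfam T -> conv T 0 = 0.
Proof. by move=> Tadd; apply: (@addrI _ (conv T 0)); rewrite -convD // !addr0. Qed.

Lemma convMn T n : addfam T -> {morph conv T : g / g *+ n}.
Proof.
move=> Tadd g; elim: n => [|n IH]; first by rewrite !mulr0n conv0.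
by rewrite !mulrS convD // IH.
Qed.

Lemma conv_conv T S g c : addfam T ->
  conv T (conv S g) c =
  \sum_(a < c.+1) \sum_(b < c.+1 | (a + b <= c)%N) T a (S b (g (c - (a + b))%N)).
Proof.
move=> Tadd; apply: eq_bigr => a _; rewrite /conv.
rewrite (big_morph _ (Tadd a) (addfam0 Tadd a)).
rewrite (big_ord_widen c.+1 (fun b => T a (S b (g (c - a - b)%N)))); last by lia.
by apply: eq_big => [b|b _]; [have := ltn_ord a; lia|rewrite subnDA].
Qed.

Lemma convC T S : addfam T -> addfam S ->
    (forall a b u, T a (S b u) = S b (T a u)) ->
  forall g, conv T (conv S g) = conv S (conv T g).
Proof.
move=> Tadd Sadd TS g; apply/funext => c; rewrite !conv_conv //.
under eq_bigr do rewrite big_mkcond.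
rewrite exchange_big /=; apply: eq_bigr => b _; rewrite -big_mkcond /=.
by apply: eq_big => a; rewrite addnC // TS.
Qed.

Lemma iter_convC T S : addfam T -> addfam S ->
    (forall a b u, T a (S b u) = S b (T a u)) ->
  forall n g, conv T (iter n (conv S) g) = iter n (conv S) (conv T g).
Proof.
by move=> Tadd Sadd TS; elim=> //= n IH g; rewrite convC // IH.
Qed.

Lemma iter_conv0 T n : addfam T -> iter n (conv T) 0 = 0.
Proof. by move=> Tadd; elim: n => //= n ->; rewrite conv0. Qed.

Definition ord_ge (m : nat) g := forall c, (c < m)%N -> g c = 0.

(** The vanishing of the low coefficients of [T] is asked on the values of [g]
    only: the lowest mode of the current depends on the vector. *)
Lemma ord_ge_conv T b m g : addfam T ->
    (forall a c, (a < b)%N -> T a (g c) = 0) -> ord_ge m g ->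
  ord_ge (b + m) (conv T g) /\ conv T g (b + m)%N = T b (g m).
Proof.
move=> Tadd Tg gm.
have zero c (a : 'I_c.+1) : (c <= b + m)%N ->
    (a != b :> nat) || (c != b + m)%N -> T a (g (c - a)%N) = 0.
  move=> cbm ne; case: (ltnP a b) => [/Tg//|ab].
  by rewrite gm ?addfam0 //; have := ltn_ord a; lia.
split=> [c cbm|].
  by apply: big1 => a _; apply: zero; rewrite ?(ltnW cbm) // (ltn_eqF cbm) orbT.
have bc : (b < (b + m).+1)%N by lia.
rewrite /conv (bigD1 (Ordinal bc)) //= addKn big1 ?addr0 // => a ab.
by apply: zero; rewrite // -val_eqE /= in ab *; rewrite ab.
Qed.

End Series.

(** * The leading coefficient of a power of a truncated current *)

Section Leading.
Variables (V : zmodType) (I : Type) (Y : I -> nat -> V -> V) (b : I -> nat).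
Variable M : nat.
Hypothesis Yadd : forall j, addfam (Y j).
Hypothesis YC : forall j l a c u, Y j a (Y l c u) = Y l c (Y j a u).
Hypothesis bM : forall j, (b j <= M)%N.
Implicit Types (js : seq I) (g : nat -> V).

Definition total js a u := \sum_(j <- js) Y j a u.
Definition total_trunc js a u := if (a <= M)%N then total js a u else 0.

(** The series on which each current [Y j] has order at least [b j] and square
    zero. Since the operators commute, both properties survive the application
    of further currents, which is what makes inductions possible. *)
Definition adapted g :=
  (forall j a c, (a < b j)%N -> Y j a (g c) = 0) /\
  (forall j, conv (Y j) (conv (Y j) g) = 0).

Lemma total_add js : addfam (total js).
Proof.
by move=> a u v; rewrite /total -big_split; apply: eq_bigr => j _; rewrite Yadd.
Qed.

Lemma total_trunc_add js : addfam (total_trunc js).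
Proof.
by move=> a u v; rewrite /total_trunc; case: ifP; rewrite ?addr0 // total_add.
Qed.

Lemma YtotalC j js a c u : Y j a (total js c u) = total js c (Y j a u).
Proof.
rewrite /total (big_morph _ (Yadd j a) (addfam0 (Yadd j) a)).
by apply: eq_bigr => l _; rewrite YC.
Qed.

Lemma total_truncC js a c u :
  total js a (total_trunc js c u) = total_trunc js c (total js a u).
Proof.
rewrite /total_trunc; case: ifP => _; last by rewrite addfam0 //; exact: total_add.
rewrite [RHS]/total -[total js c u]/(\sum_(l <- js) Y l c u).
rewrite (big_morph _ (total_add js a) (addfam0 (@total_add js) a)).
by apply: eq_bigr => l _; rewrite YtotalC.
Qed.

Lemma adapted_conv j g : adapted g -> adapted (conv (Y j) g).
Proof.
move=> [g1 g2]; split=> [l a c ab|l].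
  rewrite /conv (big_morph _ (Yadd l a) (addfam0 (Yadd l) a)) big1 // => i _.
  by rewrite YC g1 // addfam0.
have CC := convC (Yadd l) (Yadd j) (YC l j).
by rewrite CC CC g2 conv0.
Qed.

Lemma conv_total_cons j js g :
  conv (total (j :: js)) g = conv (Y j) g + conv (total js) g.
Proof.
apply/funext => c; rewrite seqD /conv -big_split; apply: eq_bigr => a _.
by rewrite /total big_cons.
Qed.

(** The binomial formula for [(Y j + total js)^p]: the terms quadratic in
    [Y j] vanish. *)
Lemma iter_total_cons j js p g : adapted g ->
  iter p (conv (total (j :: js))) g =
  iter p (conv (total js)) g + iter p.-1 (conv (total js)) (conv (Y j) g) *+ p.
Proof.
move=> [_ gYY]; have tadd := @total_add js.
have CC := iter_convC (Yadd j) tadd (YtotalC j js).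
elim: p => [|p IH]; first by rewrite mulr0n addr0.
rewrite iterS IH conv_total_cons !convD // !convMn // !CC gYY iter_conv0 //.
rewrite mul0rn addr0 addrCA; congr (_ + _); rewrite mulrS; congr (_ + _).
by case: p {IH} => [|p]; rewrite ?mulr0n.
Qed.

(** A nonzero term of the power [p] of the total current uses [p] currents once
    each; the others are missing, and each of them accounts for at most [M] of the
    full order [\sum_j b j]. For [p = size js] every current occurs, in
    [(size js)`!] orders, and the lowest coefficient is explicit. *)
Lemma iter_total js p m g : adapted g -> ord_ge m g ->
  [/\ (size js < p)%N -> iter p (conv (total js)) g = 0,
      (p <= size js)%N -> forall c,
        (c + (size js - p) * M < m + \sum_(j <- js) b j)%N ->
        iter p (conv (total js)) g c = 0 &
      iter (size js) (conv (total js)) g (m + \sum_(j <- js) b j)%N =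
      foldr (fun j u => Y j (b j) u) (g m) (rev js) *+ (size js)`!].
Proof.
elim: js p m g => [|j js IH] p m g ga gm.
  split; last by rewrite big_nil addn0 mulr1n.
    case: p => //= p _; apply/funext => c; apply: big1 => a _.
    by rewrite /total big_nil.
  by rewrite leqn0 => /eqP -> c; rewrite big_nil /= mul0n !addn0 => /gm.
have ga' := adapted_conv j ga.
have [gm' gm0] := ord_ge_conv (Yadd j) (fun a c => @ga.1 j a c) gm.
split=> /=.
- case: p => // p; rewrite ltnS => jsp; rewrite iter_total_cons //=.
  have [+ _ _] := IH p.+1 _ _ ga gm; rewrite /= => -> //; last by lia.
  have [+ _ _] := IH p _ _ ga' gm'; by rewrite add0r => ->; rewrite ?mul0rn.
- move=> pjs c; rewrite big_cons => cm; rewrite iter_total_cons //= seqD.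
  have -> : iter p (conv (total js)) g c = 0.
    case: (ltnP (size js) p) => [sp|ps].
      by have [-> // _ _] := IH p _ _ ga gm.
    have [_ + _] := IH p _ _ ga gm; apply=> //; move: cm (bM j).
    rewrite subSn // mulSn; lia.
  rewrite add0r; case: p pjs cm => [|p] pjs cm; first by rewrite mulr0n.
  have [_ H _] := IH p _ _ ga' gm'.
  have := H pjs c; rewrite subSS in cm; rewrite /= => E.
  by rewrite seqMn E ?mul0rn //; lia.
- rewrite -iterS iter_total_cons // seqD.
  have [-> // _ _] := IH (size js).+1 _ _ ga gm; rewrite add0r.
  have [_ _ H] := IH 0%N _ _ ga' gm'.
  rewrite big_cons addnCA addnA /= seqMn H gm0 rev_cons -cats1 foldr_cat /=.
  by rewrite -mulrnA mulnC factS.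
Qed.

(** Discarding the modes above [M] does not alter the leading coefficient: an
    occurrence of the discarded part [H] raises the order by more than [M],
    which exceeds what a missing current can lower it by. *)
Lemma total_trunc_leading js g : adapted g ->
  iter (size js) (conv (total_trunc js)) g (\sum_(j <- js) b j)%N =
  foldr (fun j u => Y j (b j) u) (g 0%N) (rev js) *+ (size js)`!.
Proof.
move=> ga; have gm : ord_ge 0%N g by [].
set k := size js; set B := (\sum_(j <- js) b j)%N.
pose H a u := if (a <= M)%N then 0 else total js a u.
have tadd := @total_add js; have gadd := @total_trunc_add js.
have Hadd : addfam H.
  by move=> a u v; rewrite /H; case: ifP => _; rewrite ?addr0 // tadd.
have GE f : conv (total_trunc js) f = conv (total js) f - conv H f.
  apply/esym/eqP; rewrite subr_eq; apply/eqP.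
  rewrite -[LHS]/(conv (total js) f) funeqE => c.
  rewrite seqD /conv -big_split; apply: eq_bigr => a _.
  by rewrite /total_trunc /H /=; case: ifP => _; rewrite ?addr0 ?add0r.
have Hord f c : (forall c', (c' + M < c)%N -> f c' = 0) -> conv H f c = 0.
  move=> fc; apply: big1 => a _; rewrite /H; case: leqP => // Ma.
  by rewrite fc ?addfam0 //; have := ltn_ord a; lia.
have CC := iter_convC tadd gadd (@total_truncC js).
(* Interpolate between X^k and G^k by the products G^q X^p, using
   G^(q+1) X^p = G^q X^(p+1) - H G^q X^p. *)
have main q p : (p + q <= k)%N ->
    let f := iter q (conv (total_trunc js)) (iter p (conv (total js)) g) in
    (forall c, (c + (k - (p + q)) * M < B)%N -> f c = 0) /\
    ((p + q)%N = k -> f B = iter k (conv (total js)) g B).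
  elim: q p => [|q IH] p pq /=.
    rewrite addn0 in pq; rewrite addn0 in pq *; split=> [c cB|-> //].
    have [_ H0 _] := iter_total js p ga gm; exact: H0.
  rewrite GE CC -iterS.
  have [IH1 _] := IH p ltac:(lia); have [IH2 IH3] := IH p.+1 ltac:(lia).
  rewrite /= in IH1 IH2 IH3; split=> [c cB|pk]; rewrite seqB.
    rewrite IH2 ?(Hord _ c) ?subr0 //; last by rewrite addSnnS.
    move=> c' cc'; apply: IH1.
    have -> : (k - (p + q) = (k - (p + q.+1)).+1)%N by lia.
    by rewrite mulSn; lia.
  rewrite IH3 ?addSnnS // (Hord _ B) ?subr0 // => c' cc'; apply: IH1.
  have -> : (k - (p + q) = 1)%N by lia.
  by rewrite mul1n.
have [_ ->] := main k 0%N (leqnn k); last by rewrite add0n.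
by have [_ _] := iter_total js k ga gm; rewrite add0n.
Qed.

End Leading.

(** * The current e(z) on the fermionic space *)

Section Currents.
Variable K : numFieldType.
Implicit Types (u v : fock K) (B : nat) (i j p q r s : int).

Lemma mul_fermionC p q u :
  mul_fermion p (mul_fermion q u) = - mul_fermion q (mul_fermion p u).
Proof. by apply/eqP; rewrite -addr_eq0 mul_mul_fermion. Qed.

(** [psi(i)] and [phi(i)] kill [u] for [i < -B], in terms of positions. *)
Definition bounded B u := forall p, p < - (2 * B%:Z) -> mul_fermion p u = 0.

Lemma bounded_lin B c u v : bounded B u -> bounded B v -> bounded B (c *: u + v).
Proof. by move=> uB vB p pB; rewrite linearP /= uB // vB // scaler0 addr0. Qed.

Lemma bounded0 B : bounded B 0.
Proof. by move=> p _; rewrite linear0. Qed.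

Lemma bounded_sum B n (F : nat -> fock K) :
  (forall a, bounded B (F a)) -> bounded B (\sum_(a < n) F a).
Proof.
move=> FB; elim/big_ind: _ => [|u v uB vB|a _]; [exact: bounded0| |exact: FB].
by rewrite -[u]scale1r; apply: bounded_lin.
Qed.

Lemma bounded_mul B p u : bounded B u -> bounded B (mul_fermion p u).
Proof.
move=> uB q qB; have := mul_mul_fermion q p u.
by rewrite [mul_fermion q u]uB // linear0 addr0.
Qed.

Lemma bounded_le B B' u : (B <= B')%N -> bounded B u -> bounded B' u.
Proof. by move=> BB' uB p pB; apply: uB; lia. Qed.

Lemma exists_bounded u : exists B, bounded B u.
Proof.
rewrite (fockE u); elim/big_ind: _ => [|x y [B xB] [B' yB']|D _].
- by exists 0%N; apply: bounded0.
- exists (maxn B B'); rewrite -[x]scale1r.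
  by apply: bounded_lin; [apply: bounded_le xB|apply: bounded_le yB']; lia.
- have [B DB] := occ_bound D; exists B => p pB.
  by rewrite linearZ /= mul_fermionU (DB p).1 ?scaler0 //; lia.
Qed.

(** On a bounded vector the sum defining [e_i] is finite, [psi(a)] and
    [phi(i - a)] being both nonzero only for [-B <= a <= i + B]. *)
Lemma fock_eE B M i u : bounded B u -> i + 2 * B%:Z < M%:Z ->
  fock_e i u = \sum_(a < M) psi (a%:Z - B%:Z) (phi (i + B%:Z - a%:Z) u).
Proof.
move=> uB iM; rewrite /fock_e.
pose r := [seq a%:Z - B%:Z | a <- iota 0 M].
rewrite (fsbigE r) //.
- rewrite (eq_bigl xpredT); last by move=> a; exact: mem_set.
  rewrite big_map -{1}[M]subn0 big_mkord.
  by apply: eq_bigr => a _; congr (psi _ (phi _ u)); lia.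
- by rewrite map_inj_uniq ?iota_uniq // => a b; lia.
- move=> a _ ar; case: (ltrP a (- B%:Z)) => aB.
    by rewrite /psi /phi mul_fermionC [mul_fermion (2 * a) u]uB ?linear0 ?oppr0 //; lia.
  rewrite /psi /phi [mul_fermion (2 * _ + 1) u]uB ?linear0 //.
  suff : M%:Z <= a + B%:Z by lia.
  rewrite leNgt; apply: contra ar => aM; apply/mapP.
  exists (absz (a + B%:Z)); last by lia.
  by rewrite mem_iota; lia.
Qed.

Lemma fock_e_linear i : linear (fock_e i : fock K -> fock K).
Proof.
move=> c u v; have [B uB] := exists_bounded u; have [B' vB'] := exists_bounded v.
pose C := maxn B B'; pose M := (`|i| + 2 * C).+1.
have uC : bounded C u by apply: bounded_le uB; lia.
have vC : bounded C v by apply: bounded_le vB'; lia.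
have iM : i + 2 * C%:Z < M%:Z by lia.
rewrite !(@fock_eE C M) //; last exact: bounded_lin.
rewrite scaler_sumr -big_split; apply: eq_bigr => a _.
by rewrite /psi /phi !linearP.
Qed.

HB.instance Definition _ i :=
  GRing.isLinear.Build K (fock K) (fock K) _ (fock_e i) (fock_e_linear i).

Lemma bounded_e B i u : bounded B u -> bounded B (fock_e i u).
Proof.
move=> uB; rewrite (@fock_eE B (`|i| + 2 * B).+1) //; last by lia.
apply: (@bounded_sum B _ (fun a => psi (a%:Z - B%:Z) (phi (i + B%:Z - a%:Z) u))) => a.
by do 2!apply: bounded_mul.
Qed.

Lemma mul_fermion_pairC p q r s u :
  mul_fermion p (mul_fermion q (mul_fermion r (mul_fermion s u))) =
  mul_fermion r (mul_fermion s (mul_fermion p (mul_fermion q u))).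
Proof.
rewrite (mul_fermionC q r) (mul_fermionC q s) !linearN /= opprK.
by rewrite (mul_fermionC p r) (mul_fermionC p s) linearN opprK.
Qed.

Lemma fock_eC i j u : fock_e i (fock_e j u) = fock_e j (fock_e i u).
Proof.
have [B uB] := exists_bounded u; pose M := (`|i| + `|j| + 2 * B).+1.
have uiB := bounded_e i uB; have ujB := bounded_e j uB.
rewrite (@fock_eE B M i) //; last by lia.
rewrite (@fock_eE B M j (fock_e i u)) //; last by lia.
rewrite (@fock_eE B M i u) //; last by lia.
rewrite (@fock_eE B M j u) //; last by lia.
rewrite /psi /phi.
under eq_bigr do rewrite !linear_sum.
under [RHS]eq_bigr do rewrite !linear_sum.
rewrite exchange_big /=; apply: eq_bigr => a _; apply: eq_bigr => b _.
exact: mul_fermion_pairC.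
Qed.

(** The relation e(z)^2 = 0. In psi(z) phi(z) psi(z) phi(z) the exchange of the
    indices of the two psi changes the sign of each term and preserves the
    total degree. *)
Lemma fock_e_square B c u : bounded B u ->
  \sum_(a < c.+1)
     fock_e (a%:Z - 2 * B%:Z) (fock_e ((c - a)%N%:Z - 2 * B%:Z) u) = 0.
Proof.
move=> uB; set S := \sum_(a < _) _.
pose I4 := ('I_c.+1 * 'I_c.+1)%type.
pose F (x y : I4) : fock K :=
  psi (x.1%:Z - B%:Z) (phi (x.2%:Z - B%:Z)
    (psi (y.1%:Z - B%:Z) (phi (y.2%:Z - B%:Z) u))).
have eE (a : nat) v : bounded B v -> (a <= c)%N ->
    fock_e (a%:Z - 2 * B%:Z) v =
    \sum_(x : I4 | (x.1 + x.2 == a)%N)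
       psi (x.1%:Z - B%:Z) (phi (x.2%:Z - B%:Z) v).
  move=> vB ac; rewrite (@fock_eE B a.+1) //; last by lia.
  rewrite (big_ord_widen c.+1
    (fun p : nat => psi (p%:Z - B%:Z) (phi (a%:Z - 2 * B%:Z + B%:Z - p%:Z) v)));
    last by lia.
  rewrite -(pair_big_dep xpredT (fun p q : 'I_c.+1 => p + q == a)%N
    (fun p q : 'I_c.+1 => psi (p%:Z - B%:Z) (phi (q%:Z - B%:Z) v))) /= big_mkcond.
  apply: eq_bigr => p _; case: ifP => pa; last first.
    by rewrite big1 // => q /eqP; lia.
  have qc : (a - p < c.+1)%N by lia.
  rewrite (big_pred1 (Ordinal qc)) => [|q0] /=; last by rewrite -val_eqE /=; lia.
  by congr (psi _ (phi _ v)); lia.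
have SE : S = \sum_(x : I4) \sum_(y : I4 | (x.1 + x.2 + (y.1 + y.2) == c)%N) F x y.
  transitivity (\sum_(a < c.+1) \sum_(x : I4 | (x.1 + x.2 == a)%N)
                  \sum_(y : I4 | (y.1 + y.2 == c - a)%N) F x y).
    apply: eq_bigr => a _; have ac := ltn_ord a.
    rewrite (eE a _ (bounded_e _ uB) ac); apply: eq_bigr => x _.
    by rewrite (eE _ _ uB (leq_subr _ _)) /phi /psi !linear_sum.
  rewrite (exchange_big_dep xpredT) //=; apply: eq_bigr => x _.
  case: (ltnP (x.1 + x.2) c.+1)%N => xc; last first.
    rewrite [LHS]big_pred0 => [|a]; last by have := ltn_ord a; lia.
    by rewrite big_pred0 // => y; lia.
  rewrite (big_pred1 (Ordinal xc)) => [|a] /=; last by rewrite -val_eqE /= eq_sym.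
  by apply: eq_bigl => y /=; lia.
have SN : S = - S.
  rewrite SE pair_big_dep /= -sumrN.
  pose swap (z : I4 * I4) : I4 * I4 := ((z.2.1, z.1.2), (z.1.1, z.2.2)).
  have swapK : involutive swap by case=> [[? ?] [? ?]].
  rewrite [LHS](reindex_inj (inv_inj swapK)) /=.
  apply: eq_big => [z|z _].
    by rewrite addnACA (addnC (z.2.1 : nat) z.1.1) addnACA.
  rewrite /F /psi /phi /=.
  set p := 2 * _; set q := _ + 1; set r := 2 * (z.1.1%:Z - _).
  rewrite (mul_fermionC q r) linearN /= (mul_fermionC p r) opprK.
  by rewrite (mul_fermionC p q) linearN.
have : S *+ 2 = 0 by rewrite mulr2n {2}SN subrr.
rewrite -scaler_nat => /eqP; rewrite scaler_eq0 pnatr_eq0 /= => /eqP.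
exact.
Qed.

(** [psi(a)] and [phi(i - a)] have positions [2 a] and [2 (i - a) + 1], of sum
    [2 i + 1]. They are free in [v(m)] only above [m], and two distinct such
    positions have sum at least [(m + 1) + (m + 2)], whence [i >= m + 1];
    equality leaves one term, which fills the two lowest free positions. *)
Lemma fock_e_vmaya (m : int) :
  (forall i, i < m + 1 -> fock_e i << vmaya m >> = 0 :> fock K) /\
  exists2 s : K, s != 0 & fock_e (m + 1) << vmaya m >> = s *: << vmaya (m + 2) >>.
Proof.
have F0 i a : 2 * a <= m \/ 2 * (i - a) + 1 <= m ->
    psi a (phi (i - a) << vmaya m >>) = 0 :> fock K.
  have M0 p : p <= m -> mul_fermion p << vmaya m >> = 0 :> fock K.
    by move=> pm; rewrite mul_fermionU occ_vmaya pm.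
  case=> am; rewrite /psi /phi; last by rewrite [mul_fermion (_ + 1) _]M0 ?linear0.
  by rewrite mul_fermionC [mul_fermion (2 * a) _]M0 ?linear0 ?oppr0.
split=> [i im|]; first by apply: fsbig1 => a _; apply: F0; lia.
(* 2 a0 is the even one of the positions m + 1 and m + 2. *)
pose a0 := ((m + 2) %/ 2)%Z.
rewrite /fock_e (fsbigE [:: a0]) //=; last first.
  by move=> a _; rewrite inE => /eqP aa0; apply: F0; rewrite /a0 in aa0; lia.
rewrite big_cons big_nil ifT ?addr0; last exact: mem_set.
rewrite /psi /phi mul_fermionU occ_vmaya ifF; last by rewrite /a0; lia.
rewrite linearZ /= mul_fermionU occ_toggle occ_vmaya ifF; last by rewrite /a0; lia.
rewrite scalerA; set s := _ * _; exists s; first by rewrite mulf_neq0 // signr_eq0.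
congr (_ *: << _ >>); apply: occ_inj => q; rewrite !occ_toggle !occ_vmaya /a0; lia.
Qed.

End Currents.

(** * The action on the tensor power *)

Section Tensor.
Variables (K : numFieldType) (k : nat).
Implicit Types (t : {ffun 'I_k -> maya}) (j l : 'I_k) (i : int) (D : maya).

Lemma freeg_ext (B : choiceType) (W : lmodType K)
    (f g : {linear {freeg B / K} -> W}) :
  (forall x : B, f << x >> = g << x >>) -> f =1 g.
Proof.
move=> fg u; rewrite -(freeg_sumE u) !linear_sum; apply: eq_bigr => x _.
by rewrite -[coeff x u]mulr1 -freegUZ !linearZ fg.
Qed.

Definition update t j D : {ffun 'I_k -> maya} :=
  [ffun l => if l == j then D else t l].

HB.instance Definition _ t j :=
  GRing.isLinear.Build K (fock K) (fock_tensor K k) _ (put t j) (fglift_is_linear _).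

Lemma putU t j D : put t j << D >> = << update t j D >> :> fock_tensor K k.
Proof. by rewrite /put liftU scale1r. Qed.

Lemma putE t j (x : fock K) :
  put t j x = \sum_(D <- dom x) coeff D x *: (<< update t j D >> : fock_tensor K k).
Proof.
rewrite {1}(fockE x) linear_sum; apply: eq_bigr => D _.
by rewrite linearZ /= putU.
Qed.

Definition factor_e j i : fock_tensor K k -> fock_tensor K k :=
  fglift (fun t : {ffun 'I_k -> maya} => put t j (fock_e i << t j >>)).

HB.instance Definition _ j i :=
  GRing.isLinear.Build K (fock_tensor K k) (fock_tensor K k) _ (factor_e j i)
    (fglift_is_linear _).

HB.instance Definition _ g i :=
  GRing.isLinear.Build K (fock_tensor K k) (fock_tensor K k) _ (@tensor_act K k g i)
    (fglift_is_linear _).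

Lemma factor_eU j i t : factor_e j i << t >> = put t j (fock_e i << t j >>).
Proof. by rewrite /factor_e liftU scale1r. Qed.

Lemma tensor_act_e i u : tensor_act sl2_e i u = \sum_j factor_e j i u.
Proof.
pose s u := \sum_j factor_e j i u.
have slin : linear s.
  move=> c x y; rewrite /s scaler_sumr -big_split; apply: eq_bigr => j _.
  exact: linearP.
pose sL := GRing.isLinear.Build K (fock_tensor K k) (fock_tensor K k) _ s slin.
pose S : {linear fock_tensor K k -> fock_tensor K k} := HB.pack s sL.
apply: (freeg_ext (f := tensor_act sl2_e i) (g := S)) => t.
rewrite /S /= /s /tensor_act liftU scale1r.
by apply: eq_bigr => j _; rewrite factor_eU.
Qed.

Lemma factor_e_put j i t (x : fock K) :
  factor_e j i (put t j x) = put t j (fock_e i x).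
Proof.
apply: (freeg_ext (f := factor_e j i \o put t j) (g := put t j \o fock_e i)) => D.
rewrite /= putU factor_eU /update ffunE eqxx !putE.
apply: eq_bigr => D' _; congr (_ *: << _ >>); apply/ffunP => l.
by rewrite !ffunE; case: eqP.
Qed.

Lemma factor_eC j l i i' u :
  factor_e j i (factor_e l i' u) = factor_e l i' (factor_e j i u).
Proof.
apply: (freeg_ext (f := factor_e j i \o factor_e l i')
                  (g := factor_e l i' \o factor_e j i)) => t /=.
rewrite !factor_eU; case: (eqVneq j l) => [<-|jl].
  by rewrite !factor_e_put fock_eC.
have E j' l' x i0 : j' != l' -> factor_e j' i0 (put t l' x) =
    \sum_(D <- dom x) \sum_(D' <- dom (fock_e i0 (<< t j' >> : fock K)))
      (coeff D x * coeff D' (fock_e i0 (<< t j' >> : fock K))) *: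
        (<< update (update t l' D) j' D' >> : fock_tensor K k).
  move=> jl'; rewrite putE linear_sum; apply: eq_bigr => D _.
  rewrite linearZ /= factor_eU /update ffunE (negbTE jl') putE scaler_sumr.
  by apply: eq_bigr => D' _; rewrite scalerA.
rewrite !E // 1?eq_sym // exchange_big /=.
apply: eq_bigr => D _; apply: eq_bigr => D' _; rewrite mulrC.
congr (_ *: << _ >>); apply/ffunP => n; rewrite !ffunE.
by case: (eqVneq n l) => [->|//]; rewrite eq_sym (negbTE jl).
Qed.

Lemma env_neg_zero : @env_neg K k (fun=> 0).
Proof.
have -> : (fun=> 0) = (fun x : fock_tensor K k => 0 *: x).
  by apply/funext => x; rewrite scale0r.
exact: env_scale (env_one _ _).
Qed.

Lemma env_neg_sum n (f : nat -> fock_tensor K k -> fock_tensor K k) :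
  (forall a, @env_neg K k (f a)) -> @env_neg K k (fun x => \sum_(a < n) f a x).
Proof.
move=> fE; elim: n => [|n IH].
  under eq_fun do rewrite big_ord0; exact: env_neg_zero.
by under eq_fun do rewrite big_ord_recr; apply: env_add.
Qed.

(** The modes of the current on the factor [j], shifted so that those below
    [-2B], which kill the vectors of interest, disappear; the modes [e_i] with
    [i <= 0] have shifted index at most [2B]. *)
Definition mode_e B j (a : nat) := factor_e j (a%:Z - 2 * B%:Z).

Lemma mode_e_add B j : addfam (mode_e B j).
Proof. by move=> a u v; rewrite /mode_e linearD. Qed.

Lemma total_mode_e B a u :
  total (mode_e B) (enum 'I_k) a u = tensor_act sl2_e (a%:Z - 2 * B%:Z) u.
Proof. by rewrite tensor_act_e /total big_enum. Qed.

Lemma env_neg_iter B q c :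
  @env_neg K k (fun u => iter q (conv (total_trunc (mode_e B) (2 * B) (enum 'I_k)))
                          (const_series u) c).
Proof.
elim: q c => [|q IH] c /=.
  by case: c => [|c]; [exact: env_one|exact: env_neg_zero].
rewrite /conv.
apply: (@env_neg_sum c.+1
  (fun a u => total_trunc _ _ _ a (iter q _ (const_series u) (c - a)%N))) => a.
rewrite /total_trunc; case aB: (a <= 2 * B)%N; last exact: env_neg_zero.
under eq_fun do rewrite total_mode_e.
by apply: (@env_mul _ _ (tensor_act sl2_e _)); [apply: env_gen; lia|exact: IH].
Qed.

(** The lowest nonzero mode on each factor listed in [js] raises this factor by
    two sites. *)
Lemma raise_factors (m : 'I_k -> int) (B : nat) (b : 'I_k -> nat) (js : seq 'I_k) :
    (forall j, (b j)%:Z = m j + 1 + 2 * B%:Z) -> uniq js ->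
  exists2 s : K, s != 0 &
    foldr (fun j u => mode_e B j (b j) u) << [ffun j => vmaya (m j)] >> js =
    s *: << [ffun j => vmaya (m j + (if j \in js then 2 else 0))] >>.
Proof.
move=> bE; elim: js => [_|j js IH /= /andP[jjs ujs]].
  exists 1; rewrite ?oner_neq0 // scale1r; congr << _ >>.
  by apply/ffunP => j; rewrite !ffunE addr0.
have [s s0 ->] := IH ujs.
have [_ [s' s'0 eE]] := @fock_e_vmaya K (m j).
exists (s * s'); first by rewrite mulf_neq0.
rewrite /mode_e linearZ /= factor_eU ffunE (negbTE jjs) addr0.
have -> : (b j)%:Z - 2 * B%:Z = m j + 1 by rewrite bE addrK.
rewrite eE linearZ /= putU scalerA; congr (_ *: << _ >>).
apply/ffunP => l; rewrite !ffunE inE; case: eqVneq => [->|] //=.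
Qed.

(** [total_trunc_leading] on the tensor product of the [v(m j)]. The condition
    [m j < 0] says that the needed mode [e_(m j + 1)] of each factor is one of
    the allowed ones. *)
Lemma env_neg_span_raise (m : 'I_k -> int) : (forall j, m j < 0) ->
  env_neg_span (<< [ffun j => vmaya (m j)] >> : fock_tensor K k)
               << [ffun j => vmaya (m j + 2)] >>.
Proof.
move=> m0; set t := [ffun j => vmaya (m j)].
(* Any common bound of the -m j makes the vectors v(m j) bounded. *)
pose B := (\sum_j absz (m j))%N.
have mB j : (absz (m j) <= B)%N by rewrite /B (bigD1 j) //= leq_addr.
pose b j := absz (m j + 1 + 2 * B%:Z).
have bE j : (b j)%:Z = m j + 1 + 2 * B%:Z by have := mB j; rewrite /b; lia.
have bM j : (b j <= 2 * B)%N by have := bE j; have := m0 j; lia.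
pose js := enum 'I_k; pose g := const_series (<< t >> : fock_tensor K k).
have modeg j c : conv (mode_e B j) g c = mode_e B j c << t >>.
  rewrite /conv big_ord_recr /= subnn big1 ?add0r // => a _.
  by rewrite /g -(subnSK (ltn_ord a)) /mode_e linear0.
have ga : adapted (mode_e B) b g.
  split=> [j a [|c] ab|j].
  - rewrite /= /mode_e factor_eU ffunE.
    by rewrite (fock_e_vmaya K (m j)).1 ?linear0 //; have := bE j; lia.
  - by rewrite /mode_e linear0.
  - apply/funext => c; rewrite [LHS]/conv.
    under eq_bigr do rewrite modeg /mode_e factor_eU factor_e_put.
    rewrite -linear_sum fock_e_square ?linear0 //.
    move=> p pB; rewrite ffunE mul_fermionU occ_vmaya ifT //.
    by have := mB j; lia.
have := total_trunc_leading (@mode_e_add B)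
  (fun j l a c u => factor_eC j l _ _ u) bM js ga.
have [|s s0 ->] := raise_factors (js := rev js) bE; first by rewrite rev_uniq enum_uniq.
rewrite -scaler_nat scalerA; set s' := _ * s => E.
have s'0 : s' != 0 by rewrite mulf_neq0 // pnatr_eq0 -lt0n fact_gt0.
exists (fun u => s'^-1 *: iter (size js)
    (conv (total_trunc (mode_e B) (2 * B) js)) (const_series u) (\sum_(j <- js) b j)%N).
  apply: env_scale; exact: env_neg_iter.
rewrite E scalerA mulVf // scale1r; congr << _ >>; apply/ffunP => j.
by rewrite !ffunE mem_rev mem_enum.
Qed.

End Tensor.

Lemma sum_count_mem_le (T : eqType) (r A : seq T) : uniq r ->
  (\sum_(j <- r) count_mem j A <= size A)%N.
Proof.
move=> r_uniq; elim: A => [|a A IH] /=; first by rewrite big1.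
rewrite big_split /= -add1n leq_add //.
have -> : (\sum_(j <- r) (a == j) = count_mem a r)%N.
  rewrite -sum1_count [RHS]big_mkcond.
  by apply: eq_bigr => j _ /=; rewrite eq_sym; case: eqP.
by rewrite count_uniq_mem // leq_b1.
Qed.

Theorem proposition3p1 (R : realType) (k : nat) (A : seq nat) :
  (1 <= k)%N ->
  all (fun a => (0 < a)%N) A ->
  sorted leq A ->
  last 0%N A = k.+1 ->
  env_neg_span (wvec R[i] k (A ++ [:: last 0%N A; last 0%N A]))
               (wvec R[i] k A).
Proof.
move=> _ _ _ lastA.
(* The two entries added to A equal k + 1, which no factor counts: they only
   increase the length, so every factor is lowered by two sites. *)
pose n (i : 'I_k) := (\sum_(1 <= j < i.+2) count_mem j A)%N.
have -> : wvec R[i] k (A ++ [:: last 0%N A; last 0%N A]) =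
    << [ffun i : 'I_k => vmaya ((n i)%:Z - (size A)%:Z - 2)] >>.
  congr << _ >>; apply/ffunP => i; rewrite !ffunE; congr vmaya.
  rewrite size_cat /= lastA /n.
  rewrite (eq_big_nat _ _ (F2 := fun j => count_mem j A)) => [|j ji].
    by lia.
  rewrite count_cat /= !(gtn_eqF _) ?addn0 //.
  by have := ltn_ord i; lia.
have -> : wvec R[i] k A =
    << [ffun i : 'I_k => vmaya ((n i)%:Z - (size A)%:Z - 2 + 2)] >>.
  by congr << _ >>; apply/ffunP => i; rewrite !ffunE subrK.
apply: env_neg_span_raise => i.
have := sum_count_mem_le A (iota_uniq 1 i.+1); rewrite /n /index_iota subn1 /=.
by lia.
Qed.
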